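(* Let $K$ be a field, let $M$ be the Chinese monoid of rank $n\ge1$, and let $\mathcal{P}$ denote the set of minimal prime ideals of $K[M]$. There exists an embedding of monoids $M\hookrightarrow\prod_{P\in\mathcal{P}} M/\rho_P$.
   Context: The Chinese monoid of rank $n$ is the monoid $M=\langle a_1,\dots,a_n\rangle$ defined by the relations $a_ja_ia_k=a_ja_ka_i=a_ka_ja_i$ for $i\le k\le j$; $K[M]$ is its monoid algebra over $K$. For an ideal $P$ of $K[M]$, $\rho_P$ is the congruence $\{(s,t)\in M\times M: s-t\in P\}$ on $M$. *)

(* Defs.v *)
From HB Require Import structures.
From mathcomp Require Import all_boot all_order all_algebra generic_quotient.
From mathcomp Require Import boolp classical_sets.
From mathcomp.multinomials Require Import monalg.

Set Implicit Arguments.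
Unset Strict Implicit.
Unset Printing Implicit Defensive.

Import GRing.Theory.

Local Open Scope classical_set_scope.
Local Open Scope quotient_scope.
Local Open Scope group_scope.

Record congruence (T : monoidType) := Congruence {
  congr_rel :> T -> T -> Prop;
  congr_refl : forall x, congr_rel x x;
  congr_sym : forall x y, congr_rel x y -> congr_rel y x;
  congr_trans : forall x y z, congr_rel x y -> congr_rel y z -> congr_rel x z;
  congr_mul : forall x x' y y',
    congr_rel x x' -> congr_rel y y' -> congr_rel (x * y) (x' * y')
}.

Section QuotientMonoid.
Variables (T : monoidType) (c : congruence T).

Let r : rel T := fun x y => `[< c x y >].

Fact congr_asbool_equiv : equiv_class_of r.
Proof.
split.
- by move=> x; apply/asboolP; exact: congr_refl.
- by move=> x y; apply/asboolP/asboolP; exact: congr_sym.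
- by move=> y x z /asboolP xy /asboolP yz; apply/asboolP/(congr_trans xy yz).
Qed.

Canonical congr_equiv := EquivRelPack congr_asbool_equiv.

Definition quotient_monoid : Type := {eq_quot congr_equiv}.
HB.instance Definition _ := Choice.on quotient_monoid.
HB.instance Definition _ := EqQuotient.on quotient_monoid.

Definition quotient_one : quotient_monoid := \pi_quotient_monoid 1.
Definition quotient_mul (x y : quotient_monoid) : quotient_monoid :=
  \pi_quotient_monoid (repr x * repr y).

Lemma quotient_eqP (x y : T) :
  \pi_quotient_monoid x = \pi_quotient_monoid y <-> c x y.
Proof.
split; first by move=> /eqmodP/asboolP.
by move=> cxy; apply/eqmodP/asboolP.
Qed.

Lemma quotient_pi_mul (x y : T) :
  \pi_quotient_monoid (x * y) =
    quotient_mul (\pi_quotient_monoid x) (\pi_quotient_monoid y).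
Proof.
have pi_repr z : c z (repr (\pi_quotient_monoid z)).
  by apply: (iffLR (quotient_eqP _ _)); rewrite reprK.
by apply: (iffRL (quotient_eqP _ _)); apply: congr_mul.
Qed.

Fact quotient_mulA : associative quotient_mul.
Proof.
move=> x y z; rewrite -[x]reprK -[y]reprK -[z]reprK.
move: (repr x) (repr y) (repr z) => {x y z} x y z.
rewrite -(quotient_pi_mul x y) -(quotient_pi_mul y z).
by rewrite -(quotient_pi_mul (x * y) z) -(quotient_pi_mul x (y * z)) mulgA.
Qed.

Fact quotient_mul1m : left_id quotient_one quotient_mul.
Proof. by move=> x; rewrite -[x]reprK -(quotient_pi_mul 1 (repr x)) mul1g. Qed.

Fact quotient_mulm1 : right_id quotient_one quotient_mul.
Proof. by move=> x; rewrite -[x]reprK -(quotient_pi_mul (repr x) 1) mulg1. Qed.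

HB.instance Definition _ :=
  isMonoid.Build quotient_monoid quotient_mulA quotient_mul1m quotient_mulm1.

End QuotientMonoid.

Section GeneratedCongruence.
Variables (T : monoidType) (R : T -> T -> Prop).

Inductive generated_rel : T -> T -> Prop :=
| gen_base x y : R x y -> generated_rel x y
| gen_refl x : generated_rel x x
| gen_sym x y : generated_rel x y -> generated_rel y x
| gen_trans x y z :
    generated_rel x y -> generated_rel y z -> generated_rel x z
| gen_mul x x' y y' : generated_rel x x' -> generated_rel y y' ->
    generated_rel (x * y) (x' * y').

Definition generated_congruence : congruence T :=
  Congruence gen_refl gen_sym gen_trans gen_mul.

End GeneratedCongruence.

Section ProductMonoid.
Variables (I : Type) (T : I -> monoidType).

Definition product_monoid : Type := forall i, T i.
HB.instance Definition _ := Choice.copy product_monoid (forall i, T i).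

Definition product_one : product_monoid := fun=> 1.
Definition product_mul (x y : product_monoid) : product_monoid :=
  fun i => x i * y i.

Fact product_mulA : associative product_mul.
Proof. by move=> x y z; apply: functional_extensionality_dep => i; exact: mulgA. Qed.

Fact product_mul1m : left_id product_one product_mul.
Proof. by move=> x; apply: functional_extensionality_dep => i; exact: mul1g. Qed.

Fact product_mulm1 : right_id product_one product_mul.
Proof. by move=> x; apply: functional_extensionality_dep => i; exact: mulg1. Qed.

HB.instance Definition _ :=
  isMonoid.Build product_monoid product_mulA product_mul1m product_mulm1.

End ProductMonoid.

(* seq T is the free monoid on T. *)
HB.instance Definition _ (T : choiceType) :=
  isMonoid.Build (seq T) (@catA T) (@cat0s T) (@cats0 T).

(* The ordinal i : 'I_n stands for the generator a_(i+1). *)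
Inductive chinese_rel (n : nat) : seq 'I_n -> seq 'I_n -> Prop :=
| chinese_rel1 (i k j : 'I_n) :
    (i <= k <= j)%N -> chinese_rel [:: j; i; k] [:: j; k; i]
| chinese_rel2 (i k j : 'I_n) :
    (i <= k <= j)%N -> chinese_rel [:: j; k; i] [:: k; j; i].

Definition chinese_monoid (n : nat) : Type :=
  quotient_monoid (generated_congruence (@chinese_rel n)).
HB.instance Definition _ n := Monoid.on (chinese_monoid n).

Lemma chinese_rel_size n (x y : seq 'I_n) :
  generated_rel (@chinese_rel n) x y -> size x = size y.
Proof.
elim=> {x y} [x y []||x y _|x y z _ + _|x x' y y' _ sx _ sy] //.
- by move=> ->.
- by rewrite !size_cat sx sy.
Qed.

(* monomType, over which monoid algebras are defined, requires that 1 has no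
   nontrivial factorization. *)
Fact chinese_unitm n (x y : chinese_monoid n) : x * y = 1 -> x = 1 /\ y = 1.
Proof.
elim/quotW: x => x; elim/quotW: y => y; rewrite -[_ * _]quotient_pi_mul.
move=> /quotient_eqP/chinese_rel_size; rewrite size_cat.
by case: x => [|//]; case: y.
Qed.

HB.instance Definition _ n := Choice_isMonomialDef.Build (chinese_monoid n)
  (@mulgA (chinese_monoid n)) (@mul1g (chinese_monoid n))
  (@mulg1 (chinese_monoid n)) (@chinese_unitm n).

Local Open Scope ring_scope.

(* Two-sided ideals. As P is additively closed, the hypothesis of prime_mul on
   products of elements says that the product ideal I J is contained in P. *)
Record is_ideal (R : nzRingType) (I : set R) : Prop := IsIdeal {
  ideal0 : I 0;
  idealB : forall x y, I x -> I y -> I (x - y);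
  idealMl : forall a x, I x -> I (a * x);
  idealMr : forall a x, I x -> I (x * a)
}.

Record is_prime_ideal (R : nzRingType) (P : set R) : Prop := IsPrimeIdeal {
  prime_is_ideal : is_ideal P;
  prime_proper : P <> [set: R];
  prime_mul : forall I J : set R, is_ideal I -> is_ideal J ->
    (forall x y, I x -> J y -> P (x * y)) -> I `<=` P \/ J `<=` P
}.

Record is_minimal_prime (R : nzRingType) (P : set R) : Prop := IsMinimalPrime {
  minimal_prime_is_prime : is_prime_ideal P;
  minimal_prime_min : forall Q : set R, is_prime_ideal Q -> Q `<=` P -> Q = P
}.

Definition minimal_prime (R : nzRingType) : Type :=
  {P : set R | is_minimal_prime P}.

Section MonoidAlgebraCongruence.
Variables (K : fieldType) (n : nat) (P : set {malg K[chinese_monoid n]}).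
Variable idP : is_ideal P.

Definition rho_rel (s t : chinese_monoid n) : Prop := P (<< s >> - << t >>).

Fact rho_refl s : rho_rel s s.
Proof. by rewrite /rho_rel subrr; exact: ideal0. Qed.

Fact rho_sym s t : rho_rel s t -> rho_rel t s.
Proof.
move=> Pst; rewrite /rho_rel -opprB -[- _]add0r.
exact (idealB idP (ideal0 idP) Pst).
Qed.

Fact rho_trans s t u : rho_rel s t -> rho_rel t u -> rho_rel s u.
Proof.
move=> Pst /rho_sym Put; rewrite /rho_rel.
have -> : << s >> - << u >> = (<< s >> - << t >>) - (<< u >> - << t >>)
    :> {malg K[chinese_monoid n]} by rewrite opprB addrA subrK.
exact (idealB idP Pst Put).
Qed.

Fact rho_mul s s' t t' :
  rho_rel s s' -> rho_rel t t' -> rho_rel (s * t)%g (s' * t')%g.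
Proof.
have mulU (x y : chinese_monoid n) :
    << (x * y)%g >> = << x >> * << y >> :> {malg K[chinese_monoid n]}.
  by rewrite /GRing.mul /= fgmulUU mulr1.
move=> Ps Pt; apply: (@rho_trans _ (s * t')%g); rewrite /rho_rel !mulU.
- by rewrite -mulrBr; exact (idealMl idP _ Pt).
- by rewrite -mulrBl; exact (idealMr idP _ Ps).
Qed.

Definition rho : congruence (chinese_monoid n) :=
  Congruence rho_refl rho_sym rho_trans rho_mul.

End MonoidAlgebraCongruence.

Definition minimal_prime_rho (K : fieldType) (n : nat)
    (P : minimal_prime {malg K[chinese_monoid n]}) :
    congruence (chinese_monoid n) :=
  rho (prime_is_ideal (minimal_prime_is_prime (svalP P))).

(* Main.v *)
(* A prime ideal contains a minimal prime, so it is enough to find, for s <> t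
   in M, a prime ideal that does not contain s - t.  Number the generators from
   0 and, for 0 < r <= t <= n, let M act on K[X] as follows: a_i is the
   multiplication by X for i < r, the left shift v |-> (v - v(0)) / X for i >= t,
   and the identity otherwise; M thus maps to the bicyclic monoid.  The kernel
   of this action in K[M] is prime: if t < n, every nonzero polynomial is moved
   by an element of M to a nonzero multiple of any given X^m; if t = n, the
   action is by multiplication by polynomials.
   These actions separate M.  Every element has a normal form, the product over
   j of blocks (prod_(i in s_j) a_j a_i) a_j^(e_j) where all i in s_j are below
   j; it acts as X^p (left shift)^q where p counts the letters below r in the
   blocks j < t, and varying r and t, these numbers determine all s_j and e_j. *)
From HB Require Import structures.
Require Import Defs.
From mathcomp Require Import all_boot all_order all_algebra.
From mathcomp Require Import generic_quotient zify boolp classical_sets.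
From mathcomp.multinomials Require Import monalg.

Set Implicit Arguments.
Unset Strict Implicit.
Unset Printing Implicit Defensive.

Local Open Scope quotient_scope.

(** The rerouting step of the insertion algorithm, in an abstract monoid: there [c] and [d] are the
    arcs from [j] to two letters, [g] and [a] these letters, and [s] the remaining arcs. *)
Lemma mul_pass_along (T : monoidType) (x s c d g a : T) :
  (commute c s -> commute d s -> commute g s -> c * a = g * d ->
   x * (c * s) * a = x * g * (d * s))%g.
Proof.
by move=> -> -> gs ca; rewrite -!mulgA ca [(s * (g * d))%g]mulgA -gs -mulgA.
Qed.

(** * Normal forms by insertion of generators *)

Section ChineseNormalForm.
Local Open Scope group_scope.
Variable n : nat.
Implicit Types (a b c i j k : 'I_n) (s : seq 'I_n).
Local Notation M := (chinese_monoid n).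

Definition chinese_word (w : seq 'I_n) : M := \pi_(chinese_monoid n) w.
Definition chinese_gen a : M := chinese_word [:: a].
Local Notation g := chinese_gen.

Lemma chinese_wordM (v w : seq 'I_n) :
  chinese_word (v ++ w) = chinese_word v * chinese_word w.
Proof. exact: (quotient_pi_mul (generated_congruence (@chinese_rel n))). Qed.

Lemma chinese_gen_relr i k j : (i <= k <= j)%N ->
  g j * g i * g k = g j * g k * g i.
Proof.
move=> ikj; rewrite /g -!chinese_wordM /=.
by apply/(quotient_eqP (generated_congruence (@chinese_rel n)))/gen_base; left.
Qed.

Lemma chinese_gen_rell i k j : (i <= k <= j)%N ->
  g j * g k * g i = g k * g j * g i.
Proof.
move=> ikj; rewrite /g -!chinese_wordM /=.
by apply/(quotient_eqP (generated_congruence (@chinese_rel n)))/gen_base; right.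
Qed.

Definition chinese_arc j i : M := g j * g i.
Definition chinese_arcs j s : M := \prod_(i <- s) chinese_arc j i.

(** The two relations give a_k a_j a_i = a_j a_k a_i = a_j a_i a_k. *)
Lemma commute_gen_arc i k j : (i <= k <= j)%N ->
  commute (g k) (chinese_arc j i).
Proof.
move=> ikj; rewrite /commute /chinese_arc mulgA.
by rewrite -(chinese_gen_rell ikj) (chinese_gen_relr ikj).
Qed.

Lemma commute_gen_arcs k j s : (k <= j)%N -> all (fun i => i <= k)%N s ->
  commute (g k) (chinese_arcs j s).
Proof.
move=> kj /allP sk; rewrite /chinese_arcs big_seq.
by apply: commute_prod => i /sk ik; apply: commute_gen_arc; rewrite ik.
Qed.

Lemma arc_mul_gen i k j : (i <= k <= j)%N ->
  chinese_arc j k * g i = g k * chinese_arc j i.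
Proof.
by move=> ikj; rewrite /chinese_arc chinese_gen_rell // mulgA.
Qed.

(** For [i <= k], both [g j] and [g k] commute with [chinese_arc j i]. *)
Lemma commute_arc j i k : (i <= j)%N -> (k <= j)%N ->
  commute (chinese_arc j i) (chinese_arc j k).
Proof.
wlog ik : i k / (i <= k)%N => [th|] ij kj.
  case: (leqP i k) => ik; first exact: th.
  by apply: commute_sym; apply: th => //; apply: ltnW.
by apply: commuteM; apply: commute_sym; apply: commute_gen_arc;
  rewrite ?ik ?ij /=.
Qed.

Lemma commute_arc_arcs j i s : (i <= j)%N -> all (fun k => k <= j)%N s ->
  commute (chinese_arc j i) (chinese_arcs j s).
Proof.
move=> ij /allP sj; rewrite /chinese_arcs big_seq.
by apply: commute_prod => k /sj kj; apply: commute_arc.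
Qed.

Lemma arcs_cons j i s :
  chinese_arcs j (i :: s) = chinese_arc j i * chinese_arcs j s.
Proof. by rewrite /chinese_arcs big_cons. Qed.

Lemma arcs_cat j s t :
  chinese_arcs j (s ++ t) = chinese_arcs j s * chinese_arcs j t.
Proof. by rewrite /chinese_arcs big_cat. Qed.

Lemma perm_arcs j s t : all (fun k => k <= j)%N s -> perm_eq s t ->
  chinese_arcs j s = chinese_arcs j t.
Proof.
elim: s t => [|i s IHs] t /= => [_|/andP[ij sj]].
  by rewrite perm_sym => /perm_nilP ->.
move=> st; have it : i \in t by rewrite -(perm_mem st) mem_head.
case/path.splitPr: it st => t1 t2.
rewrite perm_sym -cat1s perm_catCA /= perm_cons perm_sym => st.
have t1j : all (fun k => k <= j)%N t1.
  by move: sj; rewrite (perm_all _ st) all_cat => /andP[].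
rewrite arcs_cons (IHs _ sj st) !arcs_cat arcs_cons.
by rewrite mulgA (commute_arc_arcs ij t1j) -mulgA.
Qed.

(** The index counts the blocks, one for each generator below it, possibly trivial. The list [s]
    need not be sorted: arcs of one block commute, so only its multiset matters. *)
Inductive chinese_nf : nat -> M -> Prop :=
| chinese_nf1 : chinese_nf 0 1
| chinese_nfS j x s (e : nat) : chinese_nf j x -> all (fun i => i < j)%N s ->
    chinese_nf j.+1 (x * chinese_arcs j s * g j ^+ e).

Lemma chinese_nf_one m : (m <= n)%N -> chinese_nf m 1.
Proof.
elim: m => [|m IHm] mn; first exact: chinese_nf1.
have := @chinese_nfS (Ordinal mn) 1 [::] 0 (IHm (ltnW mn)) isT.
by rewrite /chinese_arcs big_nil expg0 !mulg1.
Qed.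

(* One step of the insertion algorithm: [a] is absorbed by the last block if
   possible; otherwise either [a] or the largest lower end of an arc of the last
   block (the arc being rerouted to [a]) is passed on to the previous blocks. *)
Lemma chinese_nf_mul_gen m x a : chinese_nf m x -> (a < m)%N ->
  chinese_nf m (x * g a).
Proof.
move=> cx; elim: cx a => {m x} [//|j x s k cx IHx sj a].
rewrite ltnS leq_eqVlt => /orP[/eqP/val_inj ->|aj].
  by rewrite -mulgA -expgSr; apply: chinese_nfS.
have sj' : all (fun i => i <= j)%N s by apply: sub_all sj => i /ltnW.
case: k => [|k]; last first.
  (* One [g j] of the power joins [g a] to form a new arc, which commutes with [g j] and with the
     other arcs of the block. *)
  have -> : x * chinese_arcs j s * g j ^+ k.+1 * g a
            = x * chinese_arcs j (a :: s) * g j ^+ k.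
    have cja : commute (g j) (chinese_arc j a) by apply: commute_gen_arc; lia.
    rewrite expgSr -!mulgA -/(chinese_arc j a); congr (x * _).
    rewrite (commute_sym (commuteX k (commute_sym cja))) arcs_cons.
    by rewrite (commute_arc_arcs (ltnW aj) sj') mulgA.
  by apply: chinese_nfS; rewrite //= aj.
rewrite expg0 mulg1.
have [sa|/allPn[b sb ab]] := boolP (all (fun i => i <= a)%N s).
  rewrite -mulgA -(commute_gen_arcs (ltnW aj) sa) mulgA.
  by have := chinese_nfS 0 (IHx a aj) sj; rewrite expg0 mulg1.
(* As [i] is maximal, [g i] commutes with the arcs that remain once one copy of [i] is removed. *)
pose i := [arg max_(c > b in s) (c : nat)].
have [si maxi] : i \in s /\ forall c, c \in s -> (c <= i)%N.
  by rewrite /i; case: arg_maxnP.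
have ai : (a < i)%N by apply: leq_trans (maxi b sb); lia.
have ij : (i < j)%N by move/allP: sj; apply.
have sE := perm_to_rem si.
have s'i : all (fun c => c <= i)%N (rem i s).
  by apply/allP => c /mem_rem /maxi.
have s'j : all (fun c => c < j)%N (rem i s).
  by apply/allP => c /mem_rem; move/allP: sj; apply.
have s'j' : all (fun c => c <= j)%N (rem i s).
  by apply: sub_all s'j => c /ltnW.
have -> : x * chinese_arcs j s * g a = x * g i * chinese_arcs j (a :: rem i s).
  rewrite (perm_arcs sj' sE) !arcs_cons.
  have iai : (a <= i <= j)%N by rewrite (ltnW ai) (ltnW ij).
  exact: mul_pass_along (commute_arc_arcs (ltnW ij) s'j')
    (commute_arc_arcs (ltnW aj) s'j') (commute_gen_arcs (ltnW ij) s'i)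
    (arc_mul_gen iai).
have := @chinese_nfS j _ (a :: rem i s) 0 (IHx i ij).
by rewrite expg0 mulg1; apply; rewrite /= aj.
Qed.

Lemma chinese_ind (P : M -> Prop) :
  P 1 -> (forall x a, P x -> P (x * g a)) -> forall x, P x.
Proof.
move=> P1 PS; elim/quotW => w; rewrite -/(chinese_word w).
elim/last_ind: w => [//|w a IHw]; rewrite -cats1 chinese_wordM; exact: PS.
Qed.

Lemma chinese_nfP x : chinese_nf n x.
Proof.
elim/chinese_ind: x => [|x a cx]; first exact: chinese_nf_one.
exact: chinese_nf_mul_gen.
Qed.

End ChineseNormalForm.

(** * Action on polynomials through the bicyclic monoid *)

Section ShiftAction.
(* Imported globally, GRing.Theory would shadow the monoid_morphism of monoids
   that the theorem refers to. *)
Import GRing.Theory.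
Local Open Scope ring_scope.
Variables (K : fieldType) (n : nat).
Local Notation M := (chinese_monoid n).
Local Notation g := chinese_gen.
Implicit Types (a i j : 'I_n) (w : seq 'I_n) (u v : {poly K}) (z : M).

(** This is X^p D^q, where D is the left shift and D X = 1. *)
Definition shift (p q : nat) v : {poly K} := drop_poly q v * 'X^p.

Lemma shift0 v : shift 0 0 v = v.
Proof. by rewrite /shift drop_poly0l expr0 mulr1. Qed.

Lemma drop_polyA (k l : nat) v :
  drop_poly k (drop_poly l v) = drop_poly (l + k) v.
Proof. by apply/polyP => i; rewrite !coef_drop_poly -addnA (addnC k). Qed.

(** The product of the bicyclic monoid: the truncated subtractions record how much of D^q and X^p'
    survives cancellation. *)
Lemma shiftM p q p' q' v :
  shift p q (shift p' q' v) = shift (p + (p' - q)) (q' + (q - p')) v.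
Proof. by rewrite /shift drop_polyMXn drop_polyA -mulrA -exprD (addnC p). Qed.

Lemma shift_linear p q : linear (shift p q).
Proof.
by move=> c u v; rewrite /shift drop_polyD drop_polyZ mulrDl scalerAl.
Qed.

Lemma shiftXn p q m : (q <= m)%N -> shift p q 'X^m = 'X^(p + (m - q)).
Proof.
by move=> /subnK {1}<-; rewrite /shift exprD drop_polyMXn_id -exprD addnC.
Qed.

(** If [q < q'], only the second operator kills X^q; if [q = q'], the image of X^q determines
    [p]. *)
Lemma shift_inj p q p' q' : shift p q =1 shift p' q' -> p = p' /\ q = q'.
Proof.
wlog qq' : p q p' q' / (q <= q')%N => [th|] E.
  case: (leqP q q') => qq'; first exact: th.
  by have [] := th _ _ _ _ (ltnW qq') (fsym E).
have [lt_qq'|le_q'q] := ltnP q q'.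
  have := E 'X^q; rewrite shiftXn // /shift drop_poly_eq0 ?size_polyXn // mul0r.
  by move/eqP; rewrite expf_eq0 polyX_eq0 andbF.
have /(congr1 (fun v => size v)) := E 'X^q'.
by rewrite !shiftXn // !size_polyXn => -[]; lia.
Qed.

Section Thresholds.
Variables r t : nat.

(* The letters below [r] act as the right shift, those from [t] on as the left
   shift (which kills [1]), and the others trivially. *)
Definition letter_act a : {poly K} -> {poly K} := shift (a < r)%N (t <= a)%N.

Definition word_act w v := foldr letter_act v w.

Definition chinese_act z v := word_act (repr z) v.

Lemma word_act_cat w w' v : word_act (w ++ w') v = word_act w (word_act w' v).
Proof. by rewrite /word_act foldr_cat. Qed.

Lemma word_act_shift w : exists p q, word_act w =1 shift p q.
Proof.
elim: w => [|a w [p [q IHw]]]; first by exists 0%N, 0%N => v; rewrite shift0.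
by eexists; eexists => v /=; rewrite IHw /letter_act shiftM.
Qed.

Lemma chinese_act_shift z : exists p q, chinese_act z =1 shift p q.
Proof. exact: word_act_shift. Qed.

Lemma chinese_act_linear z : linear (chinese_act z).
Proof.
by have [p [q E]] := chinese_act_shift z => c u v; rewrite !E shift_linear.
Qed.

Hypothesis le_rt : (r <= t)%N.

(** If [j < t], only powers of X occur, and they commute; otherwise [j] acts as the left shift,
    which cancels a multiplication by X to its right. *)
Lemma word_act_chinese w w' : generated_rel (@chinese_rel n) w w' ->
  word_act w =1 word_act w'.
Proof.
elim=> {w w'} [w w' []|w|w w' _|w1 w2 w3 _ E _ E'|w1 w1' w2 w2' _ E _ E'] v //;
  last by rewrite /= !word_act_cat E E'.
- move=> i k j ikj; rewrite /= /letter_act !shiftM; congr shift; lia.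
- move=> i k j ikj; rewrite /= /letter_act !shiftM; congr shift; lia.
- by rewrite E E'.
Qed.

Lemma chinese_act_word w : chinese_act (chinese_word w) =1 word_act w.
Proof.
apply: word_act_chinese.
by apply/(quotient_eqP (generated_congruence (@chinese_rel n))); rewrite reprK.
Qed.

Lemma chinese_act1 v : chinese_act 1%g v = v.
Proof. exact: (chinese_act_word [::]). Qed.

Lemma chinese_act_gen a v : chinese_act (g a) v = letter_act a v.
Proof. exact: (chinese_act_word [:: a]). Qed.

Lemma chinese_actM z z' v :
  chinese_act (z * z')%g v = chinese_act z (chinese_act z' v).
Proof.
elim/quotW: z => w; elim/quotW: z' => w'.
rewrite -/(chinese_word w) -/(chinese_word w') -chinese_wordM.
by rewrite !chinese_act_word word_act_cat.
Qed.

End Thresholds.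

(** * Letter counts, and separation of elements by the actions *)

Definition deg (p : pred nat) z := count [pred a : 'I_n | p a] (repr z).

(** The relations only permute letters, so letter counts are well defined on M. *)
Lemma chinese_rel_perm w w' : generated_rel (@chinese_rel n) w w' ->
  perm_eq w w'.
Proof.
elim=> {w w'} [w w' []|w|w w' _|w1 w2 w3 _ + _|w1 w1' w2 w2' _ E _ E'] //.
- by move=> i k j _; rewrite perm_cons (perm_catC [:: i] [:: k]).
- by move=> i k j _; rewrite (permEl (perm_catCA [:: j] [:: k] [:: i])).
- by rewrite perm_sym.
- exact: perm_trans.
- exact: perm_cat.
Qed.

Lemma deg_word p w : deg p (chinese_word w) = count [pred a : 'I_n | p a] w.
Proof.
apply/permP/chinese_rel_perm.
by apply/(quotient_eqP (generated_congruence (@chinese_rel n))); rewrite reprK.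
Qed.

Lemma deg1 p : deg p 1%g = 0%N.
Proof. exact: (deg_word p [::]). Qed.

Lemma degM p z z' : deg p (z * z')%g = (deg p z + deg p z')%N.
Proof.
elim/quotW: z => w; elim/quotW: z' => w'.
rewrite -/(chinese_word w) -/(chinese_word w') -chinese_wordM.
by rewrite !deg_word count_cat.
Qed.

Lemma deg_gen p a : deg p (g a) = p a.
Proof. by rewrite (deg_word p [:: a]) /= addn0. Qed.

Lemma degX p z e : deg p (z ^+ e)%g = (e * deg p z)%N.
Proof. by elim: e => [|e IHe]; rewrite ?deg1 // expgS degM IHe mulSn. Qed.

Lemma deg_arcs p j s :
  deg p (chinese_arcs j s) = (size s * p j + count [pred a : 'I_n | p a] s)%N.
Proof.
elim: s => [|i s IHs]; first by rewrite /chinese_arcs big_nil deg1.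
by rewrite arcs_cons degM IHs degM !deg_gen /=; lia.
Qed.

Lemma deg_block p j s e : deg p (chinese_arcs j s * g j ^+ e)%g =
  ((size s + e) * p j + count [pred a : 'I_n | p a] s)%N.
Proof. by rewrite degM degX deg_arcs deg_gen; lia. Qed.

Lemma chinese_act_deg r t z : deg (leq t) z = 0%N ->
  chinese_act r t z =1 shift (deg (fun b => b < r)%N z) 0.
Proof.
rewrite /deg /chinese_act; elim: (repr z) => [|a w IHw] /= wt v.
  by rewrite shift0.
rewrite IHw; last by lia.
by rewrite /letter_act shiftM; congr shift; lia.
Qed.

Lemma chinese_nf_deg m z : chinese_nf m z -> deg (leq m) z = 0%N.
Proof.
elim=> {m z} [|j z s e _ IHz sj]; first exact: deg1.
have gt0 : count [pred a : 'I_n | j < a]%N s = 0%N.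
  apply/eqP; rewrite -leqn0 leqNgt -has_count; apply/hasPn => i /(allP sj) /=.
  by rewrite -leqNgt => /ltnW.
rewrite -mulgA degM deg_block /= gt0 ltnn muln0 !addn0.
apply/eqP; rewrite -leqn0 -IHz; apply: sub_count => i /=; exact: ltnW.
Qed.

(** In each arc the left shift [g j] is applied after [g i], so it cancels any factor X that [g i]
    brings in. *)
Lemma chinese_act_block r t j s e : (r <= t)%N -> (t <= j)%N ->
  exists q, chinese_act r t (chinese_arcs j s * g j ^+ e)%g =1 shift 0 q.
Proof.
move=> rt tj; have letterj : letter_act r t j =1 shift 0 1.
  by move=> v; rewrite /letter_act tj ltnNge (leq_trans rt tj).
suff [q E] : exists q, chinese_act r t (chinese_arcs j s) =1 shift 0 q.
  exists (e + q)%N; elim: e => [|e IHe] v; first by rewrite mulg1 E.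
  rewrite expgSr mulgA chinese_actM // chinese_act_gen // letterj IHe shiftM.
  by congr shift; lia.
elim: s => [|i s [q E]].
  by exists 0%N => v; rewrite /chinese_arcs big_nil chinese_act1 // shift0.
eexists => v; rewrite arcs_cons !chinese_actM // !chinese_act_gen // E letterj.
rewrite /letter_act !shiftM; congr shift; case: (i < r)%N => //.
Qed.

Lemma chinese_nfS_inv m z : chinese_nf m.+1 z -> exists j (u : M) s e,
  [/\ m = j, z = (u * (chinese_arcs j s * g j ^+ e))%g, chinese_nf j u &
      all (fun i => i < j)%N s].
Proof.
move=> cz; inversion cz as [|j u s e cu sj]; exists j, u, s, e.
by split; rewrite ?mulgA.
Qed.

(** The multiplicity of [i] is the difference of the counts at the thresholds [i.+1] and [i]. *)
Lemma perm_count_lt j s s' : 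
  all (fun i => i < j)%N s -> all (fun i => i < j)%N s' ->
  (forall r, (r <= j)%N ->
     count [pred a : 'I_n | (a < r)%N] s =
     count [pred a : 'I_n | (a < r)%N] s') ->
  perm_eq s s'.
Proof.
move=> sj s'j E; apply/allP => i; rewrite mem_cat => is'; apply/eqP.
have ij : (i < j)%N by case/orP: is' => [/(allP sj)|/(allP s'j)].
have countS s1 : count [pred a : 'I_n | (a < i.+1)%N] s1 =
    (count [pred a : 'I_n | (a < i)%N] s1 + count_mem i s1)%N.
  elim: s1 => //= a s1 ->; rewrite -val_eqE /=; lia.
have := E _ ij; rewrite !countS E ?(ltnW ij) //; exact: addnI.
Qed.

Local Notation below r := (deg (fun b => b < r)%N).

Lemma chinese_nf_inj m z z' : chinese_nf m z -> chinese_nf m z' ->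
  (forall r t, (0 < r)%N -> (r <= t)%N -> (t <= m)%N ->
    chinese_act r t z =1 chinese_act r t z') ->
  z = z'.
Proof.
elim: m z z' => [|m IHm] z z'.
  by move=> cz cz' _; inversion cz; inversion cz'.
move=> cz cz' E; have dz := chinese_nf_deg cz; have dz' := chinese_nf_deg cz'.
have [j [u [s [e [mj zE cu sj]]]]] := chinese_nfS_inv cz.
have [j' [u' [s' [e' [mj' zE' cu' s'j]]]]] := chinese_nfS_inv cz'.
have jj' : j' = j by apply: val_inj; rewrite /= -mj mj'.
subst m j'; have du := chinese_nf_deg cu; have du' := chinese_nf_deg cu'.
(* At [t = j.+1] no letter of [z] or [z'] acts as the left shift, so the exponent of X counts all
   letters below [r]. *)
have Ez r : (r <= j.+1)%N -> below r z = below r z'.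
  case: r => [|r] rj; first by rewrite /deg !count_pred0.
  have [|//] := @shift_inj (below r.+1 z) 0 (below r.+1 z') 0.
  move=> v; rewrite -(chinese_act_deg _ dz) -(chinese_act_deg _ dz').
  exact: E.
(* At [t = j] the last block is a pure power of the left shift, so the exponent of X only counts
   letters of the earlier blocks. *)
have Eu r : (r <= j)%N -> below r u = below r u'.
  case: r => [|r] rj; first by rewrite /deg !count_pred0.
  have [q Eq] := @chinese_act_block r.+1 j j s e rj (leqnn j).
  have [q' Eq'] := @chinese_act_block r.+1 j j s' e' rj (leqnn j).
  have [|//] := @shift_inj (below r.+1 u) q (below r.+1 u') q'.
  move=> v; have := E r.+1 j isT rj (leqnSn j) v.
  rewrite zE zE' (chinese_actM rj u) (chinese_actM rj u') Eq Eq'.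
  rewrite !chinese_act_deg // !shiftM.
  by rewrite !(sub0n, subn0, addn0).
have ss' : perm_eq s s'.
  apply: (perm_count_lt sj s'j) => r rj; have := Ez r (leqW rj).
  rewrite zE zE' (degM _ u) (degM _ u') Eu // !deg_block /=.
  by rewrite ltnNge rj !muln0 => /addnI.
(* At [r = j.+1] every letter counts, and the last block has 2|s| + e of them. *)
have ee' : e = e'.
  have := Ez _ (leqnn _).
  have := Eu _ (leqnn _).
  have degS x : deg (leq j) x = 0%N -> below j.+1 x = below j x.
    by rewrite /deg; elim: (repr x) => //= a w IHw aw; rewrite IHw; lia.
  rewrite zE zE' (degM _ u) (degM _ u') !deg_block /= !degS //.
  by rewrite (perm_size ss') (permP ss') ltnSn !muln1 => -> /addnI/addIn/addnI.
have blockE : (chinese_arcs j s * g j ^+ e = chinese_arcs j s' * g j ^+ e')%g.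
  rewrite ee'; congr (_ * _)%g; apply: perm_arcs ss'.
  by apply: sub_all sj => i /ltnW.
(* The common block acts as D^q; comparing exponents cancels it, so [u] and [u'] act alike. *)
rewrite zE zE' blockE; congr (_ * _)%g; apply: IHm => // r t r0 rt tj v.
have [q Eq] := @chinese_act_block r t j s' e' rt tj.
have [p1 [q1 E1]] := chinese_act_shift r t u.
have [p2 [q2 E2]] := chinese_act_shift r t u'.
have [|pp qq] := @shift_inj p1 (q + q1) p2 (q + q2).
  move=> x; have := E r t r0 rt (leqW tj) x.
  rewrite zE zE' blockE (chinese_actM rt u) (chinese_actM rt u') Eq E1 E2.
  rewrite !shiftM.
  by rewrite !(sub0n, subn0, addn0).
by rewrite E1 E2 pp; congr shift; lia.
Qed.

End ShiftAction.

(** * Existence of minimal primes *)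

Section MinimalPrimes.
Import GRing.Theory.
Local Open Scope classical_set_scope.
Local Open Scope ring_scope.
Variable R : nzRingType.
Implicit Types (P Q : set R) (F : set (set R)).

(** If a member [P] of the chain does not contain [I], neither does any smaller member; so [J] lies
    in [P] and in these, hence in all members. *)
Lemma prime_ideal_bigcap F : F !=set0 -> (forall P, F P -> is_prime_ideal P) ->
  total_on F subset -> is_prime_ideal (\bigcap_(P in F) P).
Proof.
move=> [P0 FP0] primeF totF; split.
- split=> [P FP|x y Fx Fy P FP|a x Fx P FP|a x Fx P FP];
    have idP := prime_is_ideal (primeF P FP).
  + exact: ideal0.
  + by apply: idealB => //; [apply: Fx|apply: Fy].
  + by apply: Defs.idealMl => //; apply: Fx.
  + by apply: Defs.idealMr => //; apply: Fx.
- move=> capT; apply: (prime_proper (primeF _ FP0)).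
  apply/seteqP; split=> // x _.
  by have : (\bigcap_(P in F) P) x by [rewrite capT]; apply.
- move=> I J idI idJ IJ; have IJP P : F P -> I `<=` P \/ J `<=` P.
    by move=> FP; apply: (prime_mul (primeF P FP)) => // x y Ix Jy; apply: IJ.
  have [IF|/existsNP[P /not_implyP[FP nIP]]] :=
      pselect (forall P, F P -> I `<=` P).
    by left=> x Ix P FP; apply: IF.
  right=> x Jx Q FQ; have [QP|PQ] := totF _ _ FQ FP.
    have [IQ|] := IJP _ FQ; last by apply.
    by case: nIP => y /IQ/QP.
  by have [//|JP] := IJP _ FP; apply/PQ/JP.
Qed.

(** Zorn's lemma for the primes inside [P], ordered by reverse inclusion. *)
Lemma exists_minimal_prime P : is_prime_ideal P ->
  exists2 Q, is_minimal_prime Q & Q `<=` P.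
Proof.
move=> primeP; pose S := {Q : set R | is_prime_ideal Q /\ Q `<=` P}.
pose le (s t : S) := `[< sval t `<=` sval s >].
suff [[Q [primeQ QP]] minQ] : exists s, forall s', le s s' -> s' = s.
  exists Q => //; split=> // Q' primeQ' Q'Q.
  have Q'P : Q' `<=` P by move=> x /Q'Q/QP.
  have /minQ : le (exist _ Q (conj primeQ QP)) (exist _ Q' (conj primeQ' Q'P)).
    exact/asboolP.
  by move=> /(congr1 sval).
apply: Zorn.
- by move=> s; apply/asboolP.
- by move=> s t u /asboolP st /asboolP tu; apply/asboolP; move=> x /tu/st.
- move=> [s sP] [t tP] /asboolP /= ts /asboolP /= st; apply: eq_exist.
  by apply/seteqP.
(* The empty chain, whose intersection would be the whole ring, is bounded by [P] itself. *)
- move=> A totA; have [[s0 As0]|noA] := pselect (A !=set0); last first.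
    have PP : is_prime_ideal P /\ P `<=` P by split=> // x.
    by exists (exist _ P PP) => s As; case: noA; exists s.
  pose F := [set sval s | s in A].
  have primeF : is_prime_ideal (\bigcap_(Q in F) Q).
    apply: prime_ideal_bigcap.
    - by exists (sval s0), s0.
    - by move=> _ [s _ <-]; case: (svalP s).
    - move=> _ _ [s As <-] [t At <-].
      by have [/asboolP|/asboolP] := totA s t As At; [right|left].
  have FP : \bigcap_(Q in F) Q `<=` P.
    by move=> x Fx; apply: (svalP s0).2; apply: Fx; exists s0.
  exists (exist _ (\bigcap_(Q in F) Q) (conj primeF FP)) => s As.
  by apply/asboolP => x /=; apply; exists s.
Qed.

End MinimalPrimes.

(** * Kernel of the extended action of a monoid algebra *)

Section ActionKernel.
Import GRing.Theory.
Local Open Scope ring_scope.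
Variables (K : fieldType) (M : monomType) (h : M -> {poly K} -> {poly K}).
Hypothesis h_linear : forall x, linear (h x).
Hypothesis h1 : forall v, h (@mone M) v = v.
Hypothesis hM : forall x y v, h (mmul x y) v = h x (h y v).
Implicit Types (f : {malg K[M]}) (u v : {poly K}).

Definition malg_act f v : {poly K} := mmap polyC (h^~ v) f.

Lemma malg_actU x v : malg_act << x >> v = h x v.
Proof. by rewrite /malg_act mmapU mul1r. Qed.

Lemma malg_actB f f' v : malg_act (f - f') v = malg_act f v - malg_act f' v.
Proof. exact: mmapB. Qed.

Lemma malg_act0 v : malg_act 0 v = 0.
Proof. exact: mmap0. Qed.

Lemma malg_act_linear f : linear (malg_act f).
Proof.
move=> c u v; rewrite /malg_act !mmapE scaler_sumr -big_split /=.
by apply: eq_bigr => x _; rewrite h_linear mulrDr scalerAr.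
Qed.

HB.instance Definition _ x :=
  GRing.isLinear.Build K {poly K} {poly K} _ (h x) (h_linear x).
HB.instance Definition _ f :=
  GRing.isLinear.Build K {poly K} {poly K} _ (malg_act f) (malg_act_linear f).

Lemma malg_actM f f' v : malg_act (f * f') v = malg_act f (malg_act f' v).
Proof.
rewrite {1}/malg_act malgME raddf_sum /= [malg_act f _]mmapE.
apply: eq_bigr => x _; rewrite raddf_sum /= [malg_act f' _]mmapE.
rewrite linear_sum mulr_sumr; apply: eq_bigr => y _.
by rewrite mmapU hM !mul_polyC linearZ /= scalerA.
Qed.

Lemma malg_actZ f c v : malg_act f (c *: v) = c *: malg_act f v.
Proof. exact: linearZ. Qed.

Lemma malg_act_neq0 f v : malg_act f v != 0 ->
  exists m, malg_act f 'X^m != 0.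
Proof.
move=> fv; apply/not_existsP => f0; case/eqP: fv.
rewrite -[v]coefK poly_def linear_sum big1 // => i _.
by rewrite linearZ /=; case: eqP (f0 i) => [->|//]; rewrite scaler0.
Qed.

Definition act_kernel : set {malg K[M]} := fun f => forall v, malg_act f v = 0.

Lemma act_kernel_ideal : is_ideal act_kernel.
Proof.
split=> [v|f f' kf kf' v|f f' kf' v|f f' kf' v].
- exact: malg_act0.
- by rewrite malg_actB kf kf' subrr.
- by rewrite malg_actM kf' linear0.
- by rewrite malg_actM kf'.
Qed.

(** For [f] in [I] and [f'] in [J] outside the kernel, the hypothesis yields [x] with [f * (x * f')]
    outside it too, while [x * f'] is in [J]. *)
Lemma act_kernel_prime :
  (forall f u v, malg_act f v != 0 -> u != 0 ->
     exists x, malg_act f (h x u) != 0) ->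
  is_prime_ideal act_kernel.
Proof.
move=> hprime; split; first exact: act_kernel_ideal.
  move=> kT; have : act_kernel 1 by rewrite kT.
  move=> /(_ 1) /eqP; rewrite [malg_act _ _]malg_actU h1; exact/negP/oner_neq0.
move=> I J idI idJ IJ; apply: contrapT => /not_orP[].
move=> /existsNP[f /not_implyP[If /existsNP[v /eqP fv]]].
move=> /existsNP[f' /not_implyP[Jf' /existsNP[u /eqP f'u]]].
have [x /negP] := hprime _ _ _ fv f'u; apply.
have /IJ/(_ (Defs.idealMl idJ << x >> Jf'))/(_ u) := If.
by rewrite !malg_actM malg_actU => ->.
Qed.

End ActionKernel.

(** * Primeness of the kernels for the Chinese monoid *)

Section ChineseKernel.
Import GRing.Theory.
Local Open Scope ring_scope.
Variables (K : fieldType) (n r t : nat).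
Hypotheses (r_gt0 : (0 < r)%N) (le_rt : (r <= t)%N).
Local Notation M := (chinese_monoid n).
Local Notation act := (@chinese_act K n r t).

Lemma exists_shift_coef (u : {poly K}) m : (t < n)%N -> u != 0 ->
  exists x, exists2 c, c != 0 & act x u = c *: 'X^m.
Proof.
move=> tn u0; pose a0 : 'I_n := Ordinal (leq_ltn_trans (leq0n t) tn).
have act0 e v : act (chinese_gen a0 ^+ e)%g v = shift e 0 v.
  elim: e v => [|e IHe] v; first by rewrite chinese_act1 // shift0.
  rewrite expgS chinese_actM // chinese_act_gen // IHe /letter_act shiftM.
  congr shift => /=; lia.
(* The last generator has index [n - 1 >= t], so it acts as D, while [a0], of index [0 < r], acts as
   X. *)
pose a1 : 'I_n := rev_ord a0.
have act1 e v : act (chinese_gen a1 ^+ e)%g v = shift 0 e v.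
  elim: e v => [|e IHe] v; first by rewrite chinese_act1 // shift0.
  rewrite expgS chinese_actM // chinese_act_gen // IHe /letter_act shiftM.
  congr shift => /=; lia.
(* As many left shifts as the degree of [u] leave only its leading coefficient. *)
exists (chinese_gen a0 ^+ m * chinese_gen a1 ^+ (size u).-1)%g.
exists (lead_coef u); first by rewrite lead_coef_eq0.
rewrite chinese_actM // act0 act1 -mul_polyC /shift drop_poly0l expr0 mulr1.
congr (_ * _); apply/polyP => i; rewrite coef_drop_poly coefC lead_coefE.
case: i => [|i] //=; rewrite nth_default //.
by move: u0; rewrite -size_poly_gt0; lia.
Qed.

Lemma malg_act_commutative (f : {malg K[M]}) v : (n <= t)%N ->
  malg_act act f v = malg_act act f 1 * v.
Proof.
move=> nt; rewrite /malg_act !mmapE mulr_suml; apply: eq_bigr => x _.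
have dx : deg (leq t) x = 0%N.
  apply/eqP; rewrite -leqn0 leqNgt -has_count; apply/hasPn => a _ /=.
  by rewrite -ltnNge (leq_trans (ltn_ord a)).
rewrite !chinese_act_deg // /shift !drop_poly0l mul1r -mulrA; congr (_ * _).
exact: mulrC.
Qed.

Lemma act_kernel_chinese_prime : is_prime_ideal (act_kernel act).
Proof.
have act_lin := @chinese_act_linear K n r t.
apply: act_kernel_prime => //.
- exact: chinese_act1.
- exact: chinese_actM.
move=> f u v fv u0; have [tn|nt] := ltnP t n.
  (* Some monomial is not killed by [f], and [u] can be moved to a nonzero multiple of it. *)
  have [m fm] := malg_act_neq0 act_lin fv.
  have [x [c c0 xu]] := exists_shift_coef m tn u0.
  by exists x; rewrite xu malg_actZ // scaler_eq0 negb_or c0.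
exists 1%g; rewrite chinese_act1 // malg_act_commutative // mulf_neq0 //.
by apply: contraNneq fv => f1; rewrite malg_act_commutative // f1 mul0r.
Qed.

End ChineseKernel.

Theorem theorem3p3p2 (K : fieldType) (n : nat) (hn : (1 <= n)%N) :
  exists f : chinese_monoid n ->
      product_monoid (fun P : minimal_prime {malg K[chinese_monoid n]} =>
        quotient_monoid (minimal_prime_rho P)),
    monoid_morphism f /\ injective f.
Proof.
exists (fun x P => \pi_(quotient_monoid (minimal_prime_rho P)) x).
split; first split.
- by [].
- move=> x y; apply: functional_extensionality_dep => P.
  exact: quotient_pi_mul.
move=> x y xy; apply: (@chinese_nf_inj K n n) => [||r t r0 rt tn v];
  try exact: chinese_nfP.
(* The difference of [x] and [y] lies in every minimal prime, in particular in one inside the kernel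
   of this action. *)
have [Q minQ sub] := exists_minimal_prime (act_kernel_chinese_prime K n r0 rt).
have := congr1 (fun f => f (exist _ Q minQ)) xy.
move=> /quotient_eqP /sub /(_ v); rewrite malg_actB !malg_actU.
exact: GRing.subr0_eq.
Qed.
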